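(* Let $\mathcal{C}$ be a balanced cycle in an arbitrary weighted oriented graph $D$ and let $I_{\mathcal{C}}=(f_{\mathbf{c}})$ for some primitive binomial $f_{\mathbf{c}}$. If $f_{\mathbf{c}}$ is indispensable (as an element of $I_D$), then there do not exist two balanced cycles $\mathcal{C}_1,\mathcal{C}_2$ in $D$ that share an edge $e$ such that $E(\mathcal{C})=(E(\mathcal{C}_1)\cup E(\mathcal{C}_2))\setminus\{e\}$.
   Context: A weighted oriented graph $D=(V(D),E(D),\mathbf{w})$ has a finite simple underlying graph (no loops, no multiple edges) with $V(D)=\{x_1,\dots,x_p\}$; each edge is an ordered pair $(x_i,x_j)$ oriented from its tail $x_i$ to its head $x_j$; $\mathbf{w}:V(D)\to\mathbb{N}=\{1,2,\dots\}$ is a weight function, $w_i=\mathbf{w}(x_i)$. Let $K$ be a field. The toric ideal $I_D\subset K[e:e\in E(D)]$ is the kernel of the $K$-algebra homomorphism $K[e:e\in E(D)]\to K[x_1,\dots,x_p]$ sending the variable $e=(x_i,x_j)$ to $x_ix_j^{w_j}$. The incidence matrix $A(D)$ has rows indexed by vertices and columns by edges; the entry at (vertex $x_i$, edge $e$) is $1$ if $x_i$ is the tail of $e$, $w_i$ if $x_i$ is the head of $e$, and $0$ otherwise. Subgraphs (in particular cycles, which are cycles of the underlying undirected graph) carry the inherited orientation and weights, and the toric ideal of a subgraph is regarded inside $K[e:e\in E(D)]$. A cycle $\mathcal{C}$ is balanced if $\det A(\mathcal{C})=0$ and unbalanced otherwise. For a balanced cycle $\mathcal{C}$ the ideal $I_{\mathcal{C}}$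 is principal, generated by a primitive binomial $f_{\mathbf{c}}$ (unique up to sign). A binomial $\mathbf{e}^{\mathbf{u}}-\mathbf{e}^{\mathbf{v}}$ in a toric ideal is primitive if there is no other nonzero binomial $\mathbf{e}^{\mathbf{u}'}-\mathbf{e}^{\mathbf{v}'}$ in the ideal with $\mathbf{e}^{\mathbf{u}'}\mid\mathbf{e}^{\mathbf{u}}$ and $\mathbf{e}^{\mathbf{v}'}\mid\mathbf{e}^{\mathbf{v}}$. A binomial $f\in I_D$ is indispensable if $f$ or $-f$ belongs to every minimal binomial generating set of $I_D$. Two cycles share an edge $e$ means that they intersect exactly in $e$ and its two end vertices. *)

(* Defs.v *)
From HB Require Import structures.
From mathcomp Require Import all_boot all_order all_algebra.
From mathcomp Require Import mpoly.

Set Implicit Arguments.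
Unset Strict Implicit.
Unset Printing Implicit Defensive.

Import GRing.Theory.

Local Open Scope ring_scope.

(* Weighted oriented graphs with vertices x_0, ..., x_{p-1} and edges
   e_0, ..., e_{q-1}. Simplicity of the underlying graph forbids both repeated
   edges and pairs of opposite edges. *)
Record wograph (p q : nat) := WOGraph {
  wtail : 'I_q -> 'I_p;
  whead : 'I_q -> 'I_p;
  weight : 'I_p -> nat;
  wograph_loopless : forall e, wtail e != whead e;
  wograph_simple : injective (fun e => [set wtail e; whead e]);
  weight_gt0 : forall x, (0 < weight x)%N
}.

Definition ends p q (D : wograph p q) (e : 'I_q) : {set 'I_p} :=
  [set wtail D e; whead D e].

Definition incidence p q (D : wograph p q) : 'M[int]_(p, q) :=
  \matrix_(x < p, e < q)
    (if x == wtail D e then 1%:Z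
     else if x == whead D e then (weight D x)%:Z else 0).

Definition toric_map (K : fieldType) p q (D : wograph p q)
    (f : {mpoly K[q]}) : {mpoly K[p]} :=
  f \mPo [tuple 'X_(wtail D e) * 'X_(whead D e) ^+ weight D (whead D e)
         | e < q].

Definition toric_ideal (K : fieldType) p q (D : wograph p q)
    (f : {mpoly K[q]}) : Prop :=
  toric_map D f = 0.

(* The subring K[e : e \in S] of K[e_0, ..., e_{q-1}]. *)
Definition edge_subring (K : fieldType) q (S : {set 'I_q})
    (f : {mpoly K[q]}) : Prop :=
  forall m, m \in msupp f -> forall e, e \notin S -> m e = 0%N.

(* The toric ideal of the subgraph with edge set S: an ideal of
   K[e : e \in S], viewed as a subset of K[e_0, ..., e_{q-1}]. *)
Definition toric_ideal_sub (K : fieldType) p q (D : wograph p q)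
    (S : {set 'I_q}) (f : {mpoly K[q]}) : Prop :=
  edge_subring S f /\ toric_ideal D f.

(* I_S = (f), as ideals of K[e : e \in S]. *)
Definition toric_ideal_sub_principal (K : fieldType) p q (D : wograph p q)
    (S : {set 'I_q}) (f : {mpoly K[q]}) : Prop :=
  edge_subring S f /\
  forall g, toric_ideal_sub D S g <-> exists2 h, edge_subring S h & g = h * f.

(* The edge wcedge i joins wcvert i to wcvert (i + 1 mod wclen), in either
   orientation. *)
Record wcycle p q (D : wograph p q) := WCycle {
  wclen : nat;
  wcvert : 'I_wclen -> 'I_p;
  wcedge : 'I_wclen -> 'I_q;
  wclen_gt2 : (2 < wclen)%N;
  wcvert_inj : injective wcvert;
  wcedge_inj : injective wcedge;
  wcedge_ends :
    forall i, ends D (wcedge i) = [set wcvert i; wcvert (ordS i)]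
}.

Arguments wcvert {p q D} w _.
Arguments wcedge {p q D} w _.

Definition wcV p q (D : wograph p q) (C : wcycle D) : {set 'I_p} :=
  [set wcvert C i | i : 'I_(wclen C)].

Definition wcE p q (D : wograph p q) (C : wcycle D) : {set 'I_q} :=
  [set wcedge C i | i : 'I_(wclen C)].

(* Since wcvert and wcedge enumerate V(C) and E(C), this is A(C), with its rows
   and columns listed in the order of a traversal of C; another order changes
   the determinant at most by a sign. *)
Definition wcincidence p q (D : wograph p q) (C : wcycle D) :
    'M[int]_(wclen C) :=
  mxsub (wcvert C) (wcedge C) (incidence D).

Definition balanced p q (D : wograph p q) (C : wcycle D) : Prop :=
  \det (wcincidence C) = 0.

Definition share_edge p q (D : wograph p q) (C1 C2 : wcycle D) (e : 'I_q) :
    Prop :=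
  wcE C1 :&: wcE C2 = [set e] /\ wcV C1 :&: wcV C2 = ends D e.

Definition binomial (K : fieldType) q (u v : 'X_{1..q}) : {mpoly K[q]} :=
  'X_[u] - 'X_[v].

Definition is_binomial (K : fieldType) q (f : {mpoly K[q]}) : Prop :=
  exists u v, f = binomial K u v.

Definition primitive_binomial (K : fieldType) q
    (I : {mpoly K[q]} -> Prop) (f : {mpoly K[q]}) : Prop :=
  exists u v : 'X_{1..q},
    [/\ f = binomial K u v, f != 0, I f
      & forall u' v' : 'X_{1..q},
          binomial K u' v' != 0 -> I (binomial K u' v') ->
          (u' <= u)%MM -> (v' <= v)%MM -> binomial K u' v' = f].

Definition generated_ideal (K : fieldType) q
    (G : {mpoly K[q]} -> Prop) (f : {mpoly K[q]}) : Prop :=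
  exists2 s : seq ({mpoly K[q]} * {mpoly K[q]}),
    forall c, c \in s -> G c.2 & f = \sum_(c <- s) c.1 * c.2.

Definition generates (K : fieldType) q
    (G I : {mpoly K[q]} -> Prop) : Prop :=
  forall f, I f <-> generated_ideal G f.

Definition minimal_binomial_generating_set (K : fieldType) q
    (I G : {mpoly K[q]} -> Prop) : Prop :=
  [/\ forall g, G g -> is_binomial g,
      generates G I
    & forall H : {mpoly K[q]} -> Prop,
        (forall g, H g -> G g) -> generates H I -> forall g, G g -> H g].

Definition indispensable (K : fieldType) q
    (I : {mpoly K[q]} -> Prop) (f : {mpoly K[q]}) : Prop :=
  [/\ is_binomial f, I f
    & forall G, minimal_binomial_generating_set I G -> G f \/ G (- f)].

(* Main.v *)
(* Write f = e^u - e^v. If a third monomial e^w has the same image as e^u and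
   e^v, then f = (e^u - e^w) + (e^w - e^v), so in a finite binomial generating
   set of I_D (one exists by Dickson's lemma) f and -f can be traded for these
   two binomials; a minimal generating subset then avoids f and -f.

   Such a w exists when C is obtained from C1 and C2 by deleting their common
   edge e. The vector c = u - v lies in the kernel of A(D). Since C2 is
   balanced, the restriction of c to the path E(C2) \ e extends, by a value t
   at e, to a vector x in the kernel of A(D). If t <= 0 take w = u - x, and
   w = v + x otherwise: on the path w exchanges the roles of u and v, and its
   entry at e is |t|. As c vanishes on no edge of C, w differs from u and v. *)

Require Import Defs.
From mathcomp Require Import all_boot all_order all_algebra.
From mathcomp Require Import mpoly.
From mathcomp Require Import zify ring.
From Stdlib Require Import Classical.

Set Implicit Arguments.
Unset Strict Implicit.
Unset Printing Implicit Defensive.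

Import Order.TTheory GRing.Theory Num.Theory.

Local Open Scope ring_scope.

(* Not the binomial coefficient of mathcomp. *)
Local Notation binomial := Defs.binomial.

(** * Propagation around a cycle, and Dickson's lemma *)

Lemma ordS_closed n (P : pred 'I_n) :
  (forall i, P i -> P (ordS i)) -> forall i, P i -> forall j, P j.
Proof.
move=> PS i Pi j.
have Pit k : P (iter k (@ordS n) i) by elim: k => //= k /PS.
have it k : val (iter k (@ordS n) i) = ((i + k) %% n)%N.
  elim: k => [|k IHk] /=; first by rewrite addn0 modn_small.
  by rewrite IHk addnS -[((i + k) %% n).+1]addn1 modnDml addn1.
(* The number of steps is [j - i] modulo [n]; adding [n] first keeps the truncated subtraction from
   cutting off at 0. *)
suff -> : j = iter (j + n - i) (@ordS n) i by [].
apply: val_inj; rewrite it subnKC; last by have := ltn_ord i; lia.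
by rewrite modnDr modn_small.
Qed.

(** Induction on the number of coordinates in which the elements may still differ. Fix [x0]: an
    element that does not dominate [x0] is smaller than it in some coordinate [i], so it lies in one
    of finitely many slices on which coordinate [i] is constant, and the induction hypothesis
    applies to each slice. *)
Lemma dickson (T : eqType) (I : finType) (h : T -> I -> nat) (P : T -> Prop) :
  exists2 s : seq T, forall y, y \in s -> P y
    & forall x, P x -> exists2 y, y \in s & forall i, (h y i <= h x i)%N.
Proof.
suff gen k (A : {set I}) (Q : T -> Prop) : #|A| = k ->
    (forall x y i, Q x -> Q y -> i \notin A -> h x i = h y i) ->
    exists2 s : seq T, forall y, y \in s -> Q y
      & forall x, Q x -> exists2 y, y \in s & forall i, (h y i <= h x i)%N.
  by apply: (gen _ setT) => // x y i _ _; rewrite inE.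
elim: k A Q => [|k IHk] A Q cardA constQ.
all: have [[x0 Qx0]|Q0] := classic (exists x, Q x); last first.
all: try by exists [::] => // x Qx; case: Q0; exists x.
  exists [:: x0] => [y|x Qx]; first by rewrite inE => /eqP->.
  exists x0; first by rewrite inE.
  by move=> i; rewrite (constQ x0 x) // (cards0_eq cardA) inE.
(* The finite lists obtained for the slices in [l] are concatenated; a pair [(i, n)] stands for the
   slice where coordinate [i] has value [n]. *)
have slices (l : seq (I * nat)) :
    (forall b, b \in l -> b.1 \in A) ->
    exists2 s : seq T, forall y, y \in s -> Q y
      & forall b x, b \in l -> Q x -> h x b.1 = b.2 ->
        exists2 y, y \in s & forall i, (h y i <= h x i)%N.
  elim: l => [|[i n] l IHl] lA; first by exists [::].
  have [b bl|s sQ sdom] := IHl; first by apply: lA; rewrite inE bl orbT.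
  have iA : i \in A by apply: (lA (i, n)); rewrite inE eqxx.
  have [||s' s'Q s'dom] := IHk (A :\ i) (fun x => Q x /\ h x i = n).
  - by move: cardA; rewrite (cardsD1 i) iA => -[].
  - move=> x y j [Qx hx] [Qy hy]; rewrite in_setD1 negb_and negbK.
    by case/orP => [/eqP->|jA]; [rewrite hx hy | exact: constQ].
  exists (s ++ s') => [y|b x].
    by rewrite mem_cat => /orP[/sQ|/s'Q[]].
  rewrite inE => /orP[/eqP-> /= Qx hx|bl Qx hx].
    have [y ys yx] := s'dom x (conj Qx hx).
    by exists y; rewrite ?mem_cat ?ys ?orbT.
  by have [y ys yx] := sdom b x bl Qx hx; exists y; rewrite ?mem_cat ?ys.
pose l := [seq (i, n) | i <- enum A, n <- iota 0 (h x0 i)].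
have [|s sQ sdom] := slices l.
  by move=> b /allpairsPdep[i [n [iA _ ->]]]; rewrite mem_enum in iA.
exists (x0 :: s) => [y|x Qx]; first by rewrite inE => /orP[/eqP->|/sQ].
have [/forallP le|] := boolP [forall i, h x0 i <= h x i]%N.
  by exists x0; rewrite ?inE ?eqxx.
rewrite negb_forall => /existsP[i]; rewrite -ltnNge => lti.
have iA : i \in A by apply: contraLR lti => iA; rewrite (constQ x x0) // ltnn.
have [|y ys yx] := sdom (i, h x i) x _ Qx erefl.
  apply/allpairsPdep; exists i, (h x i).
  by rewrite mem_enum iA mem_iota add0n lti.
by exists y; rewrite // inE ys orbT.
Qed.

(** * Generated ideals and minimal generating subsets *)

Section GeneratedIdeal.
Variables (K : fieldType) (q : nat).
Implicit Types (G H I : {mpoly K[q]} -> Prop) (f g : {mpoly K[q]}).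

Lemma generated_ideal_incl G f : G f -> generated_ideal G f.
Proof.
move=> Gf; exists [:: (1, f)]; first by move=> c; rewrite inE => /eqP->.
by rewrite big_seq1 mul1r.
Qed.

Lemma generated_ideal0 G : generated_ideal G 0.
Proof. by exists [::]; rewrite ?big_nil. Qed.

Lemma generated_idealD G f g :
  generated_ideal G f -> generated_ideal G g -> generated_ideal G (f + g).
Proof.
move=> [s sG ->] [s' s'G ->]; exists (s ++ s'); last by rewrite big_cat.
by move=> c; rewrite mem_cat => /orP[/sG|/s'G].
Qed.

Lemma generated_idealM G h f : generated_ideal G f -> generated_ideal G (h * f).
Proof.
move=> [s sG ->]; exists [seq (h * c.1, c.2) | c <- s].
  by move=> _ /mapP[c /sG cG ->].
by rewrite big_map mulr_sumr; apply: eq_bigr => c _; rewrite mulrA.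
Qed.

Lemma generated_idealN G f : generated_ideal G f -> generated_ideal G (- f).
Proof. by rewrite -mulN1r; exact: generated_idealM. Qed.

Lemma generated_ideal_min G H f :
  (forall g, G g -> generated_ideal H g) ->
  generated_ideal G f -> generated_ideal H f.
Proof.
move=> GH [s sG ->]; elim: s sG => [|c s IHs] sG.
  by rewrite big_nil; exact: generated_ideal0.
rewrite big_cons; apply: generated_idealD.
  by apply: generated_idealM; apply: GH; apply: sG; rewrite inE eqxx.
by apply: IHs => c' c's; apply: sG; rewrite inE c's orbT.
Qed.

(** Induction on the size of [s]. If [s] is not minimal, some generating [H] inside [s] misses an
    element [g]; removing [g] from [s] leaves a shorter list that contains [H] and hence still
    generates. *)
Lemma minimal_generating_sublist I (s : seq {mpoly K[q]}) :
  (forall g, g \in s -> is_binomial g) -> generates (fun g => g \in s) I ->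
  exists2 G, minimal_binomial_generating_set I G & forall g, G g -> g \in s.
Proof.
have [n] := ubnP (size s).
elim: n s => // n IHn s; rewrite ltnS => les sbin sgen.
have [smin|] := classic (forall H, (forall g, H g -> g \in s) ->
    generates H I -> forall g, g \in s -> H g).
  by exists (fun g => g \in s).
move=> /not_all_ex_not[H nmin].
have [Hs {}nmin] := imply_to_and _ _ nmin.
have [Hgen {}nmin] := imply_to_and _ _ nmin.
have [g ng] := not_all_ex_not _ _ nmin.
have [gs nHg] := imply_to_and _ _ ng.
pose s' := [seq x <- s | x != g].
have s's x : x \in s' -> x \in s by rewrite mem_filter => /andP[].
have [|||G Gmin Gs'] := IHn s'.
- apply: leq_trans les; rewrite size_filter -(count_predC (fun x => x != g) s).
  rewrite -ltn_subLR // subnn -has_count; apply/hasP.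
  by exists g; rewrite //= eqxx.
- by move=> x /s's/sbin.
- move=> f; split.
    move/Hgen; apply: generated_ideal_min => x Hx.
    apply: generated_ideal_incl; rewrite mem_filter Hs // andbT.
    by apply: contra_notN nHg => /eqP<-.
  move=> s'f; apply/sgen; apply: generated_ideal_min s'f => x /s's xs.
  exact: generated_ideal_incl.
by exists G => // x /Gs'/s's.
Qed.

End GeneratedIdeal.

(** * Binomial generators of the toric ideal *)

Section ToricIdeal.
Variables (K : fieldType) (p q : nat) (D : wograph p q).
Implicit Types (f g h : {mpoly K[q]}) (u v w m : 'X_{1..q}).

(** The vector A(D)m, kept as a multi-exponent: it is the exponent of the image of the monomial with
    exponent [m]. *)
Definition vertex_degree m : 'X_{1..p} :=
  (\sum_(g < q)
     (U_(wtail D g) + U_(whead D g) *+ weight D (whead D g)) *+ m g)%MM.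

Lemma toric_mapX m : toric_map D ('X_[m] : {mpoly K[q]}) = 'X_[vertex_degree m].
Proof.
rewrite /toric_map comp_mpolyX /vertex_degree -mprodXnE.
by apply: eq_bigr => g _; rewrite tnth_mktuple mpolyXD mpolyXn.
Qed.

Lemma vertex_degreeD u v :
  vertex_degree (u + v) = (vertex_degree u + vertex_degree v)%MM.
Proof.
rewrite /vertex_degree -big_split; apply: eq_bigr => g _ /=.
by apply/mnmP => y; rewrite !(mnmDE, mulmnE) mulnDr.
Qed.

Lemma vertex_degreeE m y :
  (vertex_degree m y)%:Z = \sum_g incidence D y g * (m g)%:Z.
Proof.
rewrite /vertex_degree mnm_sumE -natz natr_sum; apply: eq_bigr => g _.
rewrite mulmnE mnmDE mulmnE !mnm1E natz PoszM mxE; congr (_ * _).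
have := wograph_loopless D g; rewrite ![y == _]eq_sym.
case: (eqVneq (wtail D g) y) => [-> |_ _].
  by rewrite eq_sym => /negbTE->.
by case: (eqVneq (whead D g) y) => [->|_]; rewrite ?mul1n.
Qed.

Lemma toric_idealD f g :
  toric_ideal D f -> toric_ideal D g -> toric_ideal D (f + g).
Proof. by rewrite /toric_ideal /toric_map rmorphD /= => -> ->; rewrite addr0. Qed.

Lemma toric_idealM h f : toric_ideal D f -> toric_ideal D (h * f).
Proof. by rewrite /toric_ideal /toric_map rmorphM /= => ->; rewrite mulr0. Qed.

Lemma toric_ideal_binomial u v :
  toric_ideal D (binomial K u v) <-> vertex_degree u = vertex_degree v.
Proof.
rewrite /toric_ideal /binomial /toric_map rmorphB /= -!/(toric_map D _).
rewrite !toric_mapX; split; last first.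
  by move=> ->; rewrite subrr.
move=> /subr0_eq/(congr1 (mcoeff (vertex_degree u))).
rewrite !mcoeffX eqxx; case: eqVneq => // _ /eqP.
by rewrite oner_eq0.
Qed.

Lemma generated_ideal_toric G f : (forall g, G g -> toric_ideal D g) ->
  generated_ideal G f -> toric_ideal D f.
Proof.
move=> GI [s sG ->]; rewrite big_seq.
apply: (big_ind (toric_ideal D)); first exact: raddf0.
  by move=> g h; exact: toric_idealD.
by move=> c /sG/GI; exact: toric_idealM.
Qed.

(** Induction on the number of terms. A monomial [m] of [f] must share its image with another
    monomial [m'] of [f], or its coefficient would survive in the image of [f]. Subtracting a
    multiple of [binomial K m m'] then removes [m] from the support and adds nothing to it. *)
Lemma toric_ideal_generated f : toric_ideal D f ->
  generated_ideal (fun g => exists u v, [/\ g = binomial K u v, u != v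
    & vertex_degree u = vertex_degree v]) f.
Proof.
have [n] := ubnP (size (msupp f)).
elim: n f => // n IHn f; rewrite ltnS => lef If.
have [->|f0] := eqVneq f 0; first exact: generated_ideal0.
have [m mf] : exists m, m \in msupp f.
  move: f0; rewrite -msupp_eq0; case: (msupp f) => // m s _.
  by exists m; rewrite inE eqxx.
have [m' [m'f neq degE]] : exists m', [/\ m' \in msupp f, m != m' &
    vertex_degree m = vertex_degree m'].
  have [/hasP[m' m'f /andP[mm' /eqP Em]]|/hasPn uniq_m] :=
    boolP (has (fun m' => (m != m') && (vertex_degree m == vertex_degree m'))
               (msupp f)); first by exists m'.
  move: If; rewrite /toric_ideal => /(congr1 (mcoeff (vertex_degree m))).
  rewrite mcoeff0 /toric_map comp_mpolyEX raddf_sum /=.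
  rewrite (bigD1_seq m) ?msupp_uniq //= big_seq_cond big1 => [|m' /andP[/uniq_m]].
    rewrite addr0 -/(toric_map D _) toric_mapX mcoeffZ.
    rewrite mcoeffX eqxx mulr1 => fm0.
    by move: mf; rewrite mcoeff_msupp fm0 eqxx.
  rewrite eq_sym => nd m'm; move: nd; rewrite m'm /= => nd.
  rewrite -/(toric_map D _) toric_mapX mcoeffZ.
  by rewrite mcoeffX eq_sym (negbTE nd) mulr0.
pose g := f@_m *: binomial K m m'.
rewrite -(subrK g f); apply: generated_idealD; last first.
  rewrite /g -mul_mpolyC; apply/generated_idealM/generated_ideal_incl.
  by exists m, m'.
have gI : toric_ideal D g.
  by rewrite /g -mul_mpolyC; apply/toric_idealM/toric_ideal_binomial.
apply: IHn; last first.
  by apply: toric_idealD; rewrite // -mulN1r; exact: toric_idealM.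
apply: leq_trans lef; have -> : size (msupp f) = (size (rem m (msupp f))).+1.
  by rewrite size_rem // prednK //; case: (msupp f) mf.
rewrite ltnS; apply: uniq_leq_size; first exact: msupp_uniq.
move=> k; rewrite mem_rem_uniq ?msupp_uniq // inE.
rewrite !mcoeff_msupp mcoeffB mcoeffZ mcoeffB !mcoeffX.
have [->|_] := eqVneq k m.
  by rewrite [m' == m]eq_sym (negbTE neq) subr0 mulr1 subrr eqxx.
rewrite sub0r /=.
have [<- _|_] := eqVneq m' k; first by rewrite -mcoeff_msupp.
by rewrite oppr0 mulr0 subr0.
Qed.

(** Dickson's lemma on pairs of exponents gives finitely many binomials. If [(u', v')] lies below
    [(u, v)], the binomial of [(u, v)] is a multiple of that of [(u', v')] plus a multiple of that
    of [(u - u', v - v')], whose total degree is smaller. *)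
Lemma toric_ideal_finitely_generated : exists2 s : seq {mpoly K[q]},
  forall g, g \in s -> exists u v, [/\ g = binomial K u v, u != v
      & vertex_degree u = vertex_degree v]
  & generates (fun g => g \in s) (toric_ideal D).
Proof.
(* A pair of exponents becomes a single vector indexed by two copies of the edge set. *)
pose h (b : 'X_{1..q} * 'X_{1..q}) (i : 'I_q + 'I_q) :=
  match i with inl j => b.1 j | inr j => b.2 j end.
have [s sP sdom] := dickson h
  (fun b => b.1 != b.2 /\ vertex_degree b.1 = vertex_degree b.2).
exists [seq binomial K b.1 b.2 | b <- s].
  by move=> _ /mapP[b /sP[nb degb] ->]; exists b.1, b.2.
move=> f; split; last first.
  apply: generated_ideal_toric => _ /mapP[b /sP[nb degb] ->].
  exact/toric_ideal_binomial.
move/toric_ideal_generated; apply: generated_ideal_min => _ [u [v [-> nuv]]].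
have [n] := ubnP (mdeg u + mdeg v)%N.
elim: n u v nuv => // n IHn u v nuv; rewrite ltnS => len degE.
have [[u' v'] /= b's le] := sdom (u, v) (conj nuv degE).
have [/= nuv' degE'] := sP _ b's.
have leu : (u' <= u)%MM by apply/mnm_lepP => i; exact: le (inl i).
have lev : (v' <= v)%MM by apply/mnm_lepP => i; exact: le (inr i).
pose u2 := (u - u')%MM; pose v2 := (v - v')%MM.
have Eu : u = (u2 + u')%MM by rewrite submK.
have Ev : v = (v2 + v')%MM by rewrite submK.
have -> : binomial K u v =
    'X_[u2] * binomial K u' v' + 'X_[v'] * binomial K u2 v2.
  by rewrite /binomial Eu Ev !mpolyXD; ring.
apply: generated_idealD.
  by apply/generated_idealM/generated_ideal_incl/mapP; exists (u', v').
have [->|nuv2] := eqVneq u2 v2.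
  by rewrite /binomial subrr mulr0; exact: generated_ideal0.
apply/generated_idealM/IHn => //.
  apply: leq_trans len; rewrite Eu Ev !mdegD.
  (* The degree drops strictly: [u'] and [v'] are distinct, so they are not both zero. *)
  have : (0 < mdeg u' + mdeg v')%N.
    rewrite lt0n addn_eq0 !mdeg_eq0; apply: contraNN nuv'.
    by move=> /andP[/eqP-> /eqP->].
  by lia.
by move: degE; rewrite Eu Ev !vertex_degreeD degE' => /addIm.
Qed.

Lemma third_monomial_dispensable u v w :
  u != v -> w != u -> w != v ->
  vertex_degree w = vertex_degree u -> vertex_degree u = vertex_degree v ->
  ~ indispensable (toric_ideal D) (binomial K u v).
Proof.
move=> nuv nwu nwv degwu deguv [_ _ indis].
pose f := binomial K u v.
have [s0 s0P s0gen] := toric_ideal_finitely_generated.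
pose s := binomial K u w :: binomial K w v ::
  [seq g <- s0 | (g != f) && (g != - f)].
have sP g : g \in s -> exists u' v', [/\ g = binomial K u' v', u' != v'
    & vertex_degree u' = vertex_degree v'].
  rewrite !inE mem_filter => /or3P[/eqP->|/eqP->|/andP[_ /s0P]] //.
    by exists u, w; rewrite eq_sym.
  by exists w, v; rewrite degwu.
have genf : generated_ideal (fun g => g \in s) f.
  have -> : f = binomial K u w + binomial K w v by rewrite /f /binomial; ring.
  by apply: generated_idealD; apply: generated_ideal_incl;
    rewrite !inE eqxx ?orbT.
have [||G Gmin Gs] := @minimal_generating_sublist K q (toric_ideal D) s.
- by move=> g /sP[u' [v' [-> _ _]]]; exists u', v'.
- move=> g; split; last first.
    apply: generated_ideal_toric => g' /sP[u' [v' [-> _ deg']]].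
    exact/toric_ideal_binomial.
  move/s0gen; apply: generated_ideal_min => g' g's.
  have [->//|ng] := eqVneq g' f.
  have [->|ng'] := eqVneq g' (- f); first exact: generated_idealN.
  by apply: generated_ideal_incl; rewrite !inE mem_filter ng ng' g's !orbT.
(* The coefficient at [w] separates [f] and [- f], where it is 0, from the two new generators, where
   it is 1 or -1. *)
have fw : f@_w = 0.
  rewrite mcoeffB !mcoeffX ![_ == w]eq_sym (negbTE nwu) (negbTE nwv).
  by rewrite subrr.
have ns g : g = f \/ g = - f -> g \notin s.
  move=> Eg; have gw : g@_w = 0.
    by case: Eg => ->; rewrite ?mcoeffN fw ?oppr0.
  rewrite !inE mem_filter !negb_or; apply/and3P; split; last first.
  - by case: Eg => ->; rewrite eqxx ?andbF.
  - apply: contra_eq_neq gw => ->; rewrite mcoeffB !mcoeffX eqxx.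
    by rewrite [v == w]eq_sym (negbTE nwv) subr0 oner_eq0.
  - apply: contra_eq_neq gw => ->; rewrite mcoeffB !mcoeffX eqxx.
    by rewrite [u == w]eq_sym (negbTE nwu) sub0r oppr_eq0 oner_eq0.
have [/Gs fs|/Gs fs] := indis G Gmin.
  by have := ns f (or_introl erefl); rewrite fs.
by have := ns (- f) (or_intror erefl); rewrite fs.
Qed.

End ToricIdeal.

(** * Left and right kernels of the incidence matrix of a cycle *)

Section Cycles.
Variables (p q : nat) (D : wograph p q).
Implicit Types (C : wcycle D) (y : 'I_p) (g e : 'I_q).

Lemma incidence_eq0 y g : (incidence D y g == 0) = (y \notin ends D g).
Proof.
rewrite mxE !inE; case: (y == wtail D g) => //=; case: (y == whead D g) => //=.
by case: (weight D y) (weight_gt0 D y).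
Qed.

Lemma wcE_ends C g y : g \in wcE C -> y \in ends D g -> y \in wcV C.
Proof.
move=> /imsetP[i _ ->]; rewrite wcedge_ends !inE => /orP[]/eqP->.
all: exact: imset_f.
Qed.

Lemma wcvert_ends C i j :
  (wcvert C i \in ends D (wcedge C j)) = (i == j) || (i == ordS j).
Proof. by rewrite wcedge_ends !inE !(inj_eq (@wcvert_inj _ _ _ C)). Qed.

(** Applied to [C1] and [C2], this supplies the edges on which the third monomial is told apart from
    the other two. *)
Lemma wcE_other_edge C e : exists2 g, g \in wcE C & g != e.
Proof.
have /card_gt0P[g] : (0 < #|wcE C :\ e|)%N.
  have cC : #|wcE C| = wclen C.
    by rewrite card_imset ?card_ord //; exact: wcedge_inj.
  rewrite -(ltn_add2l (e \in wcE C)) -cardsD1 cC addn0.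
  by apply: leq_ltn_trans (leq_b1 _) _; apply: ltnW; exact: wclen_gt2.
by rewrite !inE => /andP[ge gC]; exists g.
Qed.

(** The row of the vertex between two consecutive edges of [C] involves only these two edges of [C],
    so a zero of [c] at one edge forces a zero at the next and travels around the cycle. *)
Lemma kernel_full_support C (c : 'I_q -> int) :
  (forall g, g \notin wcE C -> c g = 0) ->
  (forall y, \sum_g incidence D y g * c g = 0) ->
  forall g0, g0 \in wcE C -> c g0 = 0 -> forall g, c g = 0.
Proof.
move=> supp ker _ /imsetP[i0 _ ->] ci0 g.
have [/imsetP[j _ ->]|/supp//] := boolP (g \in wcE C).
apply/eqP; move: j.
apply: (@ordS_closed _ (fun i => c (wcedge C i) == 0) _ i0); last exact/eqP.
move=> i /eqP ci; have := ker (wcvert C (ordS i)).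
rewrite (bigD1 (wcedge C (ordS i))) //= big1 ?addr0 => [/eqP|g' ng'].
  by rewrite mulf_eq0 incidence_eq0 wcvert_ends eqxx.
have [/imsetP[j _ Eg]|/supp->] := boolP (g' \in wcE C); last by rewrite mulr0.
move: ng'; rewrite {}Eg (inj_eq (@wcedge_inj _ _ _ C)) => nj.
have [/eqP->|] := boolP (incidence D (wcvert C (ordS i)) (wcedge C j) == 0).
  by rewrite mul0r.
rewrite incidence_eq0 negbK wcvert_ends eq_sym (negbTE nj) /=.
by rewrite (inj_eq (@ordS_inj _)) => /eqP<-; rewrite ci mulr0.
Qed.

(** A singular matrix has a nonzero left kernel vector. The column of an edge involves only its two
    end vertices, so a single zero entry of that vector would spread to all vertices of [C]. *)
Lemma balanced_left_kernel C : balanced C ->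
  exists2 l : 'I_(wclen C) -> int, forall i, l i != 0
    & forall j, \sum_i l i * incidence D (wcvert C i) (wcedge C j) = 0.
Proof.
move=> /eqP/det0P[l nl0 lA].
have ker j : \sum_i l 0 i * incidence D (wcvert C i) (wcedge C j) = 0.
  transitivity ((l *m wcincidence C) 0 j); last by rewrite lA mxE.
  by rewrite [RHS]mxE; apply: eq_bigr => i _; rewrite [wcincidence C i j]mxE.
exists (l 0) => // i; apply: contraNN nl0 => li0; apply/eqP/rowP => j.
rewrite [RHS]mxE; apply/eqP.
move: j; apply: (@ordS_closed _ (fun j => l 0 j == 0) _ i) => // k /eqP lk0.
have := ker k; rewrite (bigD1 (ordS k)) //= big1 ?addr0 => [/eqP|k' nk'].
  by rewrite mulf_eq0 incidence_eq0 wcvert_ends eqxx orbT orbF.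
have [->|kk'] := eqVneq k' k; first by rewrite lk0 mul0r.
have /eqP-> : incidence D (wcvert C k') (wcedge C k) == 0.
  by rewrite incidence_eq0 wcvert_ends negb_or kk' nk'.
by rewrite mulr0.
Qed.

End Cycles.

(** * Construction of the third monomial *)

Section ThirdMonomial.
Variables (p q : nat) (D : wograph p q) (C C1 C2 : wcycle D) (e : 'I_q).
Hypothesis bal2 : balanced C2.
Hypothesis share : share_edge C1 C2 e.
Hypothesis EC : wcE C = (wcE C1 :|: wcE C2) :\ e.
Variables u v : 'X_{1..q}.
Hypothesis deg : vertex_degree D u = vertex_degree D v.
Hypothesis suppu : forall g, g \notin wcE C -> u g = 0%N.
Hypothesis suppv : forall g, g \notin wcE C -> v g = 0%N.

Let c g : int := (u g)%:Z - (v g)%:Z.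
Let P : {set 'I_q} := wcE C2 :\ e.
Let t : int := - \sum_(g in P) incidence D (wtail D e) g * c g.

Let x g : int := if g \in P then c g else if g == e then t else 0.

Let ker_c y : \sum_g incidence D y g * c g = 0.
Proof.
under eq_bigr do rewrite mulrBr; rewrite sumrB -!vertex_degreeE deg.
exact: subrr.
Qed.

Let c_out g : g \notin wcE C -> c g = 0.
Proof. by move=> gC; rewrite /c suppu ?suppv. Qed.

Let eC1 : e \in wcE C1.
Proof. by have [/setP/(_ e)] := share; rewrite !inE eqxx => /andP[]. Qed.

Let eC2 : e \in wcE C2.
Proof. by have [/setP/(_ e)] := share; rewrite !inE eqxx => /andP[]. Qed.

Let eC : e \notin wcE C.
Proof. by rewrite EC !inE eqxx. Qed.

Let sum_x y : \sum_g incidence D y g * x g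
  = incidence D y e * t + \sum_(g in P) incidence D y g * c g.
Proof.
rewrite (bigD1 e) //=; congr (_ + _).
  by rewrite /x !inE eqxx.
rewrite big_mkcond [RHS]big_mkcond; apply: eq_bigr => g _.
rewrite /x !inE; case: (g == e) => //=.
by case: (g \in _); rewrite ?mulr0.
Qed.

Let sum_x_tail : \sum_g incidence D (wtail D e) g * x g = 0.
Proof. by rewrite sum_x mxE eqxx mul1r addNr. Qed.

(** A vertex of [C2] that is not an end of [e] is not on [C1], so every edge of [C] through it lies
    in [P], and the row sum is that of [c]. A vertex off [C2] meets no edge of [P]. *)
Let sum_x_interior y : y \notin ends D e -> \sum_g incidence D y g * x g = 0.
Proof.
move=> ye; rewrite sum_x.
have /eqP-> : incidence D y e == 0 by rewrite incidence_eq0.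
rewrite mul0r add0r.
have [yC2|yC2] := boolP (y \in wcV C2); last first.
  rewrite big1 // => g /setD1P[_ gC2].
  have /eqP-> : incidence D y g == 0.
    by rewrite incidence_eq0; apply: contraNN yC2; exact: wcE_ends.
  by rewrite mul0r.
rewrite -[RHS](ker_c y) big_mkcond; apply: eq_bigr => g _.
case: ifP => // /negbT gP.
have [gC|/c_out->] := boolP (g \in wcE C); last by rewrite mulr0.
have gC1 : g \in wcE C1.
  move: gC gP; rewrite EC !inE; case: (g == e) => //=.
  by case: (g \in wcE C2); rewrite ?orbF.
have /eqP-> : incidence D y g == 0.
  rewrite incidence_eq0; apply: contraNN ye => /(wcE_ends gC1) yC1.
  by have [_ <-] := share; rewrite inE yC1.
by rewrite mul0r.
Qed.

(* The rows of A(C2) satisfy a linear relation with nonzero coefficients, so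
   the last remaining row, that of the head of e, is annihilated too. *)
Lemma ker_x y : \sum_g incidence D y g * x g = 0.
Proof.
have [|] := boolP (y \in ends D e); last exact: sum_x_interior.
rewrite !inE => /orP[/eqP->|/eqP->]; first exact: sum_x_tail.
have [l l0 lA] := balanced_left_kernel bal2.
have /imsetP[ib _ Eb] : whead D e \in wcV C2.
  by apply: (wcE_ends eC2); rewrite !inE eqxx orbT.
have : \sum_i l i * \sum_g incidence D (wcvert C2 i) g * x g = 0.
  under eq_bigr do rewrite mulr_sumr; rewrite exchange_big /= big1 // => g _.
  have [/imsetP[j _ ->]|gC2] := boolP (g \in wcE C2).
    under eq_bigr do rewrite mulrA.
    by rewrite -mulr_suml lA mul0r.
  rewrite big1 // => i _; rewrite /x !inE (negbTE gC2) andbF.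
  by case: eqP gC2 => [->|_ _]; rewrite ?eC2 // !mulr0.
rewrite (bigD1 ib) //= [X in _ + X]big1 ?addr0 => [/eqP|i ni].
  by rewrite mulf_eq0 (negbTE (l0 ib)) -Eb => /eqP.
have [ie|ie] := boolP (wcvert C2 i \in ends D e); last first.
  by rewrite sum_x_interior // mulr0.
move: ie; rewrite !inE => /orP[/eqP->|]; first by rewrite sum_x_tail mulr0.
by rewrite Eb (inj_eq (@wcvert_inj _ _ _ C2)) (negbTE ni).
Qed.

Lemma third_monomial : u != v -> exists w,
  [/\ w != u, w != v & vertex_degree D w = vertex_degree D u].
Proof.
move=> nuv.
(* A zero of [c] on [C] would spread to all edges and give [u = v]. *)
have full g : g \in wcE C -> u g <> v g.
  move=> gC Eg; move/eqP: nuv; apply; apply/mnmP => g'.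
  have := kernel_full_support c_out ker_c gC _ g'.
  by rewrite /c Eg subrr => /(_ erefl)/eqP; rewrite subr_eq0 eqz_nat => /eqP.
have [g2 g2C2 g2e] := wcE_other_edge C2 e.
have [g1 g1C1 g1e] := wcE_other_edge C1 e.
have g2P : g2 \in P by rewrite !inE g2e.
have g1P : g1 \notin P.
  rewrite !inE g1e /=; apply/negP => g1C2.
  by have [/setP/(_ g1)] := share; rewrite !inE g1C1 g1C2 (negbTE g1e).
have g2C : g2 \in wcE C by rewrite EC !inE g2e g2C2 orbT.
have g1C : g1 \in wcE C by rewrite EC !inE g1e g1C1.
have [t0|t0] := leP t 0.
  (* This is [u - x]: on [P] it equals [u - (u - v) = v], and at [e], where [u] vanishes, it equals
     [- t], which is nonnegative. It differs from [u] at [g2] and from [v] at [g1]. *)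
  exists [multinom if g \in P then v g
                   else if g == e then `|t|%N else u g | g < q].
  split.
  - apply/eqP => /mnmP/(_ g2); rewrite mnmE g2P => E.
    by case: (full g2).
  - apply/eqP => /mnmP/(_ g1); rewrite mnmE (negbTE g1P) (negbTE g1e) => E.
    by case: (full g1).
  apply/mnmP => y; apply/eqP; rewrite -eqz_nat !vertex_degreeE -subr_eq0.
  rewrite -sumrB -oppr_eq0 -sumrN; apply/eqP; rewrite -[RHS](ker_x y).
  apply: eq_bigr => g _.
  rewrite mnmE /x; case: (g \in P); first by rewrite /c; ring.
  case: eqP => [->|_]; last by ring.
  by rewrite suppu // lez0_abs //; ring.
(* This is [v + x], with entry [t > 0] at [e]; the roles of [g1] and [g2] are exchanged. *)
exists [multinom if g \in P then u g
                 else if g == e then `|t|%N else v g | g < q].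
split.
- apply/eqP => /mnmP/(_ g1); rewrite mnmE (negbTE g1P) (negbTE g1e) => E.
  by case: (full g1).
- apply/eqP => /mnmP/(_ g2); rewrite mnmE g2P => E.
  by case: (full g2).
rewrite deg; apply/mnmP => y; apply/eqP.
rewrite -eqz_nat !vertex_degreeE -subr_eq0 -sumrB; apply/eqP.
rewrite -[RHS](ker_x y); apply: eq_bigr => g _.
rewrite mnmE /x; case: (g \in P); first by rewrite /c; ring.
case: eqP => [->|_]; last by ring.
by rewrite suppv // gez0_abs ?ltW //; ring.
Qed.

End ThirdMonomial.

(** * From the third monomial to the failure of indispensability *)

Theorem proposition3p16 (K : fieldType) (p q : nat) (D : wograph p q)
    (C : wcycle D) (f : {mpoly K[q]}) :
  balanced C ->
  primitive_binomial (toric_ideal_sub D (wcE C)) f ->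
  toric_ideal_sub_principal D (wcE C) f ->
  indispensable (toric_ideal D) f ->
  ~ exists (C1 C2 : wcycle D) (e : 'I_q),
      [/\ balanced C1, balanced C2, share_edge C1 C2 e
        & wcE C = (wcE C1 :|: wcE C2) :\ e].
Proof.
move=> _ [u [v [Ef f0 [supp If] _]]] _ indis [C1 [C2 [e [_ bal2 share EC]]]].
have nuv : u != v.
  by apply: contraNN f0 => /eqP Euv; rewrite Ef Euv /binomial subrr.
have deg : vertex_degree D u = vertex_degree D v.
  by apply/(toric_ideal_binomial K); rewrite -Ef.
(* As [u] and [v] differ, neither term of [f] cancels, so both exponents lie in the support of [f]
   and inherit its restriction to the edges of [C]. *)
have suppu g : g \notin wcE C -> u g = 0%N.
  apply: supp; rewrite Ef mcoeff_msupp mcoeffB !mcoeffX eqxx [v == u]eq_sym.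
  rewrite (negbTE nuv).
  by rewrite subr0 oner_eq0.
have suppv g : g \notin wcE C -> v g = 0%N.
  apply: supp; rewrite Ef mcoeff_msupp mcoeffB !mcoeffX eqxx (negbTE nuv).
  by rewrite sub0r oppr_eq0 oner_eq0.
have [w [nwu nwv degw]] := third_monomial bal2 share EC deg suppu suppv nuv.
by move: indis; rewrite Ef; exact: third_monomial_dispensable nwv degw deg.
Qed.
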